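(* Let $f,g:\mathbb{D}\to\mathbb{D}$ be holomorphic. There is a canonical isometry $$J_{f,g}:\mathcal{H}(g\circ f)\longrightarrow\mathcal{H}(g)\otimes\mathcal{H}(f)$$ defined on kernel functions by $$J_{f,g}\,c_{g\circ f,w}=c_{g,f(w)}\otimes c_{f,w},\qquad w\in\mathbb{D}.$$ Moreover, $$\Phi_f\circ\Phi_g=\Phi_{g\circ f}.$$
   Context: All inner products are linear in the second variable. $\mathbb{D}$ is the open unit disk, $H^2$ its Hardy space with Szegő kernel $k(z,w)=\frac{1}{1-z\overline w}$, $k_w=k(\cdot,w)$, so $h(w)=\langle k_w,h\rangle$ for $h\in H^2$; $B(H^2)$ is the algebra of bounded operators on $H^2$. For any holomorphic $\phi:\mathbb{D}\to\mathbb{D}$, the kernel $c_\phi(z,w)=\frac{1-\phi(z)\overline{\phi(w)}}{1-z\overline w}$ is positive definite on $\mathbb{D}$; its reproducing kernel Hilbert space is the de Branges-Rovnyak space $\mathcal{H}(\phi)$, and $c_{\phi,w}=c_\phi(\cdot,w)$ are its kernel functions (with dense linear span and $\langle c_{\phi,z},c_{\phi,w}\rangle=c_\phi(z,w)$). $V_\phi:H^2\to H^2\otimes\mathcal{H}(\phi)$ is the isometry determined by $V_\phi k_w=k_{\phi(w)}\otimes c_{\phi,w}$, $w\in\mathbb{D}$, and $\Phi_\phi(S)=V_\phi^{*}(S\otimes I_{\mathcal{H}(\phi)})V_\phi$ for $S\in B(H^2)$, a normal unital completely positive map. *)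

(* Defs.v *)
From HB Require Import structures.
From mathcomp Require Import all_boot all_order all_algebra.
From mathcomp Require Export complex.
From mathcomp Require Import all_classical all_reals all_analysis.
Import Order.TTheory GRing.Theory Num.Theory.
Import numFieldNormedType.Exports.

Set Implicit Arguments.
Unset Strict Implicit.
Unset Printing Implicit Defensive.

Local Open Scope classical_set_scope.
Local Open Scope ring_scope.

(** Complex Hilbert spaces.  The inner product is linear in the second
    variable, hence conjugate-linear in the first one.  Positivity and
    definiteness follow from [ipxx], norms being nonnegative and definite. *)

HB.mixin Record NormedModule_isHilbert (R : realType) V
    of CompleteNormedModule R[i] V := {
  ip : V -> V -> R[i];
  ip_linear : forall x : V, linear_for *%R (ip x);
  ip_conj : forall x y : V, ip y x = (ip x y)^*;
  ipxx : forall x : V, ip x x = `|x| ^+ 2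
}.

#[short(type="hilbertType")]
HB.structure Definition Hilbert (R : realType) :=
  { V of NormedModule_isHilbert R V & CompleteNormedModule R[i] V }.

Section BoundedOperators.
Variable R : realType.

Record bop (U V : hilbertType R) := Bop {
  bop_fun :> U -> V;
  bop_linear : linear bop_fun;
  bop_continuous : continuous bop_fun
}.

HB.instance Definition _ (U V : hilbertType R) (A : bop U V) :=
  GRing.isLinear.Build R[i] U V _ (bop_fun A) (bop_linear A).

Lemma bop_ext (U V : hilbertType R) (A B : bop U V) :
  (forall x, A x = B x) -> A = B.
Proof.
case: A B => [a la ca] [b lb cb] /= /funext eab.
by rewrite eab in la ca *; congr Bop; exact: Prop_irrelevance.
Qed.

HB.instance Definition _ (U V : hilbertType R) := gen_eqMixin (bop U V).
HB.instance Definition _ (U V : hilbertType R) := gen_choiceMixin (bop U V).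

Fact bop0_linear (U V : hilbertType R) : linear (fun _ : U => 0 : V).
Proof. by move=> a u v; rewrite scaler0 addr0. Qed.

Definition bop0 (U V : hilbertType R) : bop U V :=
  Bop (@bop0_linear U V) (fun x => cvg_cst (0 : V)).

HB.instance Definition _ (U V : hilbertType R) :=
  isPointed.Build (bop U V) (bop0 U V).

Fact bop1_linear (U : hilbertType R) : linear (fun x : U => x).
Proof. by []. Qed.

Definition bop1 (U : hilbertType R) : bop U U :=
  Bop (@bop1_linear U) (fun x => @cvg_id U (nbhs x)).

Fact bop_comp_linear (U V W : hilbertType R) (B : bop V W) (A : bop U V) :
  linear (B \o A).
Proof. by move=> a u v /=; rewrite !bop_linear. Qed.

Fact bop_comp_continuous (U V W : hilbertType R) (B : bop V W) (A : bop U V) :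
  continuous (B \o A).
Proof.
move=> x; apply: continuous_comp; [exact: bop_continuous|].
exact: bop_continuous.
Qed.

Definition bop_comp (U V W : hilbertType R) (B : bop V W) (A : bop U V) :
  bop U W := Bop (@bop_comp_linear U V W B A) (@bop_comp_continuous U V W B A).

(** The Hilbert space adjoint, obtained by classical choice as the (unique)
    bounded operator that satisfies the adjunction identity. *)
Definition adjoint (U V : hilbertType R) (A : bop U V) : bop V U :=
  get [set B : bop V U | forall u v, ip (A u) v = ip u (B v)].

Definition isometric (U V : hilbertType R) (A : bop U V) : Prop :=
  forall u, `|A u| = `|u|.

End BoundedOperators.

Section Tensor.
Variable R : realType.

(** A Hilbert space tensor product of [H] and [K] (unique up to a unique unitary
    operator compatible with the pure tensors): a completion of the algebraic
    tensor product for the inner product <a (x) b, c (x) d> = <a, c> <b, d>. *)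
Record tensor (H K : hilbertType R) := Tensor {
  tensor_sort :> hilbertType R;
  tens : H -> K -> tensor_sort;
  tens_linearl : forall b, linear (tens^~ b);
  tens_linearr : forall a, linear (tens a);
  ip_tens : forall a b c d, ip (tens a b) (tens c d) = ip a c * ip b d;
  tens_dense :
    closure [set t | exists n (a : 'I_n -> H) (b : 'I_n -> K),
                       t = \sum_(i < n) tens (a i) (b i)] = setT
}.

(** [A (x) B]: the bounded operator determined by its values on pure tensors. *)
Definition tensor_bop (H K H' K' : hilbertType R)
    (T : tensor H K) (T' : tensor H' K') (A : bop H H') (B : bop K K') :
    bop T T' :=
  get [set C : bop T T' | forall a b, C (tens T a b) = tens T' (A a) (B b)].

End Tensor.

Arguments tens {R H K} t _ _.

(** A Hilbert space of functions on [X]: [hfs_eval h] is the function that the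
    vector [h] is. *)
Record hfspace (R : realType) (X : Type) := HFSpace {
  hfs_sort :> hilbertType R;
  hfs_eval : hfs_sort -> X -> R[i];
  hfs_eval_linear : forall x, linear_for *%R (hfs_eval^~ x);
  hfs_eval_inj : injective hfs_eval
}.
Arguments hfs_eval {R X h} _ _.

(** The vector of [H] that is the function [F] ([0] if [F] is not in [H]). *)
Definition elt_of (R : realType) (X : Type) (H : hfspace R X)
  (F : X -> R[i]) : H := xget 0 [set h : H | hfs_eval h = F].

(** The reproducing kernel Hilbert space of the kernel [K]. *)
Record rkhs (R : realType) (X : Type) (K : X -> X -> R[i]) := RKHS {
  rkhs_hfs :> hfspace R X;
  rkhs_kernel : forall w, exists2 k : rkhs_hfs, hfs_eval k = K^~ w
                  & forall h : rkhs_hfs, ip k h = hfs_eval h w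
}.

Section Disk.
Variable R : realType.

Definition disk := {z : R[i] | `|z| < 1}.

(** Extension by [0] of a self-map of the disk; as the disk is open, the values
    outside of the disk do not matter for differentiability in the disk. *)
Definition disk_ext (f : disk -> disk) (z : R[i]) : R[i] :=
  oapp (fun w : disk => val (f w)) 0 (insub z).

Definition holomorphic_disk (f : disk -> disk) : Prop :=
  forall z : disk,
    derivable (disk_ext f : R[i]^o -> R[i]^o) (val z : R[i]^o) (1 : R[i]^o).

Definition szego (z w : disk) : R[i] := (1 - val z * (val w)^*)^-1.

Definition dbr_kernel (phi : disk -> disk) (z w : disk) : R[i] :=
  (1 - val (phi z) * (val (phi w))^*) / (1 - val z * (val w)^*).

Definition square_summable (a : nat -> R[i]) : Prop :=
  cvgn (series (fun n => `|a n| ^+ 2) : nat -> R[i]^o).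

Definition power_series_of (a : nat -> R[i]) (F : disk -> R[i]) : Prop :=
  forall z : disk,
    (series (fun n => a n * val z ^+ n) : nat -> R[i]^o) @ \oo
      --> (F z : R[i]^o).

(** The Hardy space H^2: the functions on the disk with square-summable Taylor
    coefficients, with the inner product of the coefficients. *)
Record hardy := Hardy {
  hardy_hfs :> hfspace R disk;
  hardy_mem : forall F : disk -> R[i],
    (exists h : hardy_hfs, hfs_eval h = F) <->
    (exists2 a, square_summable a & power_series_of a F);
  hardy_ip : forall (h1 h2 : hardy_hfs) (a b : nat -> R[i]),
    square_summable a -> power_series_of a (hfs_eval h1) ->
    square_summable b -> power_series_of b (hfs_eval h2) ->
    (series (fun n => (a n)^* * b n) : nat -> R[i]^o) @ \oo
      --> (ip h1 h2 : R[i]^o)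
}.

Definition kvec (H2 : hardy) (w : disk) : H2 := elt_of H2 (szego^~ w).

(** The de Branges-Rovnyak space H(phi) and its kernel functions. *)
Definition dBR (phi : disk -> disk) := rkhs (dbr_kernel phi).

Definition cvec (phi : disk -> disk) (Hphi : dBR phi) (w : disk) : Hphi :=
  elt_of Hphi ((dbr_kernel phi)^~ w).

(** The isometry is unique because the kernel functions span a dense subspace. *)
Definition Vop (H2 : hardy) (phi : disk -> disk) (Hphi : dBR phi)
    (T : tensor H2 Hphi) : bop H2 T :=
  get [set V : bop H2 T | isometric V /\
    forall w, V (kvec H2 w) = tens T (kvec H2 (phi w)) (cvec Hphi w)].

Definition Phi (H2 : hardy) (phi : disk -> disk) (Hphi : dBR phi)
    (T : tensor H2 Hphi) (S : bop H2 H2) : bop H2 H2 :=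
  bop_comp (adjoint (Vop T)) (bop_comp (tensor_bop T T S (bop1 Hphi)) (Vop T)).

End Disk.

(* Main.v *)
(** [c_(g o f)(z, w) = c_g(f z, f w) c_f(z, w)] says that the vectors
    [c_(g o f, w)] and [c_(g, f w) (x) c_(f, w)] have the same Gram matrix, and
    the former are total, so there is exactly one isometry [J].  As for the maps
    [Phi], matrix coefficients against Szego kernels satisfy
    [<k_z, Phi_phi(S) k_w> = <k_(phi z), S k_(phi w)> c_phi(z, w)]; applying this
    twice, the same factorization of the kernel gives the composition rule, since
    the [k_w] are total.  The operators that the definitions pick by choice exist
    by the projection and Riesz theorems and by continuous extension from dense
    spans; [S (x) 1] is bounded because a finite sum of pure tensors can be
    rewritten with pairwise orthogonal second factors. *)
From HB Require Import structures.
Require Import Defs.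
From mathcomp Require Import all_boot all_order all_algebra.
From mathcomp Require Import all_classical all_reals all_analysis.
From mathcomp Require Import ring.
Import Order.TTheory GRing.Theory Num.Theory.
Import numFieldNormedType.Exports.

Set Implicit Arguments.
Unset Strict Implicit.
Unset Printing Implicit Defensive.
Local Open Scope classical_set_scope.
Local Open Scope ring_scope.

(** * Algebra of the inner product and Cauchy-Schwarz *)

HB.instance Definition _ (R : realType) (V : hilbertType R) (x : V) :=
  GRing.isLinear.Build R[i] V R[i] *%R (ip x) (ip_linear x).

Section InnerProduct.
Context {R : realType} {V : hilbertType R}.
Implicit Types x y z : V.

Lemma ip0r x : ip x 0 = 0. Proof. exact: linear0. Qed.
Lemma ipDr x y z : ip x (y + z) = ip x y + ip x z. Proof. exact: linearD. Qed.
Lemma ipBr x y z : ip x (y - z) = ip x y - ip x z. Proof. exact: linearB. Qed.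
Lemma ipZr a x y : ip x (a *: y) = a * ip x y. Proof. exact: linearZ. Qed.
Lemma ip_sumr I (s : seq I) x (F : I -> V) :
  ip x (\sum_(i <- s) F i) = \sum_(i <- s) ip x (F i).
Proof. exact: linear_sum. Qed.

Lemma ip0l x : ip 0 x = 0. Proof. by rewrite ip_conj ip0r conjC0. Qed.
Lemma ipDl x y z : ip (y + z) x = ip y x + ip z x.
Proof. by rewrite ip_conj ipDr rmorphD (ip_conj x y) (ip_conj x z). Qed.
Lemma ipBl x y z : ip (y - z) x = ip y x - ip z x.
Proof. by rewrite ip_conj ipBr rmorphB (ip_conj x y) (ip_conj x z). Qed.
Lemma ipZl a x y : ip (a *: y) x = a^* * ip y x.
Proof. by rewrite ip_conj ipZr rmorphM (ip_conj x y). Qed.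
Lemma ip_suml I (s : seq I) x (F : I -> V) :
  ip (\sum_(i <- s) F i) x = \sum_(i <- s) ip (F i) x.
Proof.
by rewrite ip_conj ip_sumr rmorph_sum; apply: eq_bigr => i _; rewrite (ip_conj x (F i)).
Qed.

Lemma ipxx_eq0 x : (ip x x == 0) = (x == 0).
Proof. by rewrite ipxx expf_eq0 /= normr_eq0. Qed.

Lemma ip_injr x y : (forall z, ip z x = ip z y) -> x = y.
Proof.
by move=> xy; apply/eqP; rewrite -subr_eq0 -ipxx_eq0 ipBr xy subrr.
Qed.

Lemma pythagoras x y : ip x y = 0 -> `|x + y| ^+ 2 = `|x| ^+ 2 + `|y| ^+ 2.
Proof.
move=> xy0; rewrite -!ipxx ipDl !ipDr xy0 (ip_conj x y) xy0 conjC0.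
by rewrite addr0 add0r.
Qed.

Lemma parallelogram x y :
  `|x + y| ^+ 2 + `|x - y| ^+ 2 = 2 * (`|x| ^+ 2 + `|y| ^+ 2).
Proof. by rewrite -!ipxx ipBl ipDl !ipBr !ipDr; ring. Qed.

(* For [x = 0] the coefficient is the junk value [0], which is harmless. *)
Lemma ip_proj x y : ip x (y - (ip x y / `|x| ^+ 2) *: x) = 0.
Proof.
have [->|x0] := eqVneq x 0; first by rewrite ip0l.
by rewrite ipBr ipZr ipxx divfK ?subrr// expf_eq0 normr_eq0.
Qed.

(** Pythagoras for the splitting of [y] into its component along [x] and the residual of [ip_proj].
    Dropping the residual yields Cauchy-Schwarz; keeping it yields orthogonality of nearest
    points. *)
Lemma norm_proj x y : `|y| ^+ 2 =
  `|y - (ip x y / `|x| ^+ 2) *: x| ^+ 2 + `|ip x y| ^+ 2 / `|x| ^+ 2.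
Proof.
set t := ip x y / _; have -> : `|ip x y| ^+ 2 / `|x| ^+ 2 = `|t *: x| ^+ 2.
  have [->|x0] := eqVneq x 0; first by rewrite ip0l scaler0 !normr0 expr0n mul0r.
  rewrite normrZ normrM normrV ?unitfE ?expf_eq0 ?normr_eq0//.
  rewrite normrX normr_id; field.
  by rewrite normr_eq0.
rewrite addrC -pythagoras; last by rewrite ipZl ip_proj mulr0.
by rewrite addrC subrK.
Qed.

Lemma cauchy_schwarz x y : `|ip x y| <= `|x| * `|y|.
Proof.
have [->|x0] := eqVneq x 0; first by rewrite ip0l !normr0 mul0r.
rewrite -(@ler_pXn2r _ 2)// ?nnegrE ?mulr_ge0// exprMn.
rewrite mulrC -ler_pdivrMr ?exprn_gt0 ?normr_gt0//.
by rewrite (norm_proj x y) lerDr exprn_ge0.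
Qed.

End InnerProduct.

(** * Closures, Cauchy nets and infima over the partially ordered field [R[i]] *)

Section Limits.
Context {R : realType}.

Lemma closure_normP (V : normedModType R[i]) (A : set V) p :
  closure A p <-> forall e, 0 < e -> exists2 x, A x & `|p - x| < e.
Proof.
split=> [Ap e e0|Ap B].
  have [x [Ax px]] := Ap _ (nbhsx_ballx p e e0).
  by exists x => //; rewrite -ball_normE in px.
rewrite -nbhs_ballE => -[e e0 peB]; have [x Ax px] := Ap e e0.
by exists x; split => //; apply: peB; rewrite -ball_normE.
Qed.

(* Over the partially ordered [R[i]], [0 < e] implies that [e] is real, so any two
   such radii are comparable and the sets [P e] generate a filter. *)
Lemma cauchy_net_limit (V : completeNormedModType R[i]) (P : R[i] -> set V) :
  (forall e, 0 < e -> P e !=set0) ->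
  (forall e e', e <= e' -> P e `<=` P e') ->
  (forall e, 0 < e -> exists2 d, 0 < d &
     forall x y, P d x -> P d y -> `|x - y| < e) ->
  exists p, forall e, 0 < e -> exists2 x, P e x & `|p - x| < e.
Proof.
move=> P0 mP cP; set F := filter_from [set e | 0 < e] P.
have FF : Filter F.
  apply: filter_from_filter; first by exists 1; exact: ltr01.
  move=> i j i0 j0.
  case/orP: (real_leVge (gtr0_real i0) (gtr0_real j0)) => ij.
    by exists i => // x Px; split => //; exact: mP Px.
  by exists j => // x Px; split => //; exact: mP Px.
have pF : ProperFilter F by exact: filter_from_proper.
have /cauchy_cvg cF : cauchy F.
  apply: cauchy_exP => e /cP[d d0 cd]; have [x Px] := P0 _ d0.
  by exists x, d => // y Py; rewrite -ball_normE; exact: cd.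
exists (lim F) => e e0.
have [d d0 dP] : F (ball (lim F) e) by apply: cF; exact: nbhsx_ballx.
case/orP: (real_leVge (gtr0_real e0) (gtr0_real d0)) => [ed|de].
  have [x Px] := P0 _ e0; exists x => //.
  by have := dP _ (mP _ _ ed _ Px); rewrite -ball_normE.
have [x Px] := P0 _ d0; exists x; first exact: mP Px.
by have := dP _ Px; rewrite -ball_normE.
Qed.

(** Nonnegative elements of [R[i]] are real, so the infimum can be taken among the real parts and
    embedded back. *)
Lemma complex_inf (A : set R[i]) : A !=set0 -> (forall x, A x -> 0 <= x) ->
  exists2 d, (forall x, A x -> d <= x) &
    forall e, 0 < e -> exists2 x, A x & x < d + e.
Proof.
move=> [a Aa] A0; pose B := [set complex.Re x | x in A].
have hB : has_inf B.
  split; first by exists (complex.Re a), a.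
  exists 0 => _ [x Ax <-]; have := A0 _ Ax.
  by rewrite lecE => /andP[].
have Ar x : A x -> x = (complex.Re x)%:C%C.
  by move=> /A0 /ger0_real /RRe_real.
exists (inf B)%:C%C => [x Ax|e e0].
  by rewrite (Ar _ Ax) lecR; apply: ge_inf; [case: hB|exists x].
have eR := esym (RRe_real (gtr0_real e0)).
rewrite eR in e0 *; rewrite ltcR in e0.
have [_ [x Ax <-] xe] := inf_adherent e0 hB.
by exists x => //; rewrite (Ar _ Ax) -rmorphD ltcR.
Qed.

Lemma real_le_eps_mul (c x y : R[i]) : 0 <= c ->
  (forall e, 0 < e -> x <= y + c * e) -> x <= y.
Proof.
move=> c0 xy; apply/ler_addgt0Pr => e e0.
(* Dividing by [c + 1] instead of [c] covers the case [c = 0]. *)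
have c1 : 0 < c + 1 by rewrite ltr_wpDl.
apply: (le_trans (xy (e / (c + 1)) _)); first by rewrite divr_gt0.
rewrite lerD2l mulrCA ler_piMr ?ltW// ltr_pdivrMr// mul1r.
by rewrite ltrDl ltr01.
Qed.

End Limits.

(** * Orthogonal projection onto the closure of a subspace *)

Section Projection.
Context {R : realType} {V : hilbertType R}.

(** Almost-nearest points of [L] to [u] form a Cauchy net by the parallelogram law, and [p] is their
    limit. Since [L] need not be closed, [p] lies only in its closure. *)
Lemma orthogonal_projection (L : set V) (u : V) : L 0 ->
  (forall a x y, L x -> L y -> L (a *: x + y)) ->
  exists2 p, closure L p & forall m, L m -> ip m (u - p) = 0.
Proof.
move=> L0 Llin.
have LD x y : L x -> L y -> L (x + y).
  by move=> Lx Ly; rewrite -(scale1r x); exact: Llin.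
have LZ a x : L x -> L (a *: x).
  by move=> Lx; rewrite -(addr0 (_ *: _)); exact: Llin.
have [||d dle dlt] := @complex_inf R [set `|u - l| ^+ 2 | l in L].
- by exists (`|u - 0| ^+ 2), 0.
- by move=> _ [l _ <-]; rewrite exprn_ge0.
pose P (e : R[i]) := L `&` [set l | `|u - l| ^+ 2 < d + e].
have [|||p pP] := @cauchy_net_limit R V P.
- by move=> e /dlt[_ [l Ll <-] le]; exists l.
- by move=> e e' ee' l [Ll le]; split => //=; apply: (lt_le_trans le); rewrite lerD2l.
(* The midpoint of [x] and [y] is in [L], so the parallelogram law bounds the square of [|x - y|]
   strictly by 4 (d + e^2/4) - 4 d = e^2. *)
- move=> e e0; exists (e ^+ 2 / 4); first by rewrite divr_gt0 ?exprn_gt0.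
  move=> x y [Lx xd] [Ly yd] /=.
  rewrite -(@ltr_pXn2r _ 2)// ?nnegrE ?(ltW e0)//.
  have := parallelogram (u - x) (u - y).
  have -> : u - x + (u - y) = 2 *: (u - 2^-1 *: (x + y)).
    rewrite scalerBr scalerA divff// scale1r scaler_nat mulr2n.
    by rewrite opprD addrACA.
  have -> : u - x - (u - y) = - (x - y).
    by rewrite !opprB addrC addrA subrK.
  rewrite normrN normrZ exprMn => pE.
  have := dle _ (ex_intro2 _ _ _ (LZ 2^-1 _ (LD _ _ Lx Ly)) erefl).
  move: pE xd yd; rewrite /= normr_nat.
  set a := `|u - 2^-1 *: _| ^+ 2; set b := `|x - y| ^+ 2.
  set p := `|u - x| ^+ 2; set q := `|u - y| ^+ 2 => pE pd qd da.
  have -> : b = 2 * (p + q) - 2 ^+ 2 * a by rewrite -pE addrC addKr.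
  have -> : e ^+ 2 = 2 * ((d + e ^+ 2 / 4) + (d + e ^+ 2 / 4)) - 2 ^+ 2 * d.
    by field.
  apply: ltr_leD; last by rewrite lerN2 ler_wpM2l.
  by rewrite ltr_pM2l// ltrD.
exists p.
  by apply/closure_normP => e /pP[x [Lx _] px]; exists x.
move=> m Lm; apply/eqP; rewrite -normr_le0.
(* Write [u - p] as [(u - x) - (p - x)] with [x] in [L]; each term contributes at most [|m|] times
   [e]. *)
apply: (@real_le_eps_mul _ (2 * `|m|)) => [|e e0]; first by rewrite mulr_ge0.
rewrite add0r.
(* The radius is the smaller of [e] and [e ^+ 2], which gives both bounds for a single [x]. *)
have [x [Lx xd] px] : exists2 x, P (e ^+ 2) x & `|p - x| < e.
  case/orP: (real_leVge (gtr0_real e0) (gtr0_real (exprn_gt0 2 e0))) => ee.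
    have [x [Lx xd] px] := pP _ e0; exists x => //; split => //=.
    by apply: (lt_le_trans xd); rewrite lerD2l.
  have [x Px px] := pP _ (exprn_gt0 2 e0).
  by exists x => //; exact: lt_le_trans ee.
have -> : u - p = (u - x) - (p - x) by rewrite opprB addrA subrK.
rewrite ipBr (le_trans (ler_normB _ _))// mulrDl mulrDl mul1r; apply: lerD.
  rewrite -(@ler_pXn2r _ 2)// ?nnegrE ?mulr_ge0 ?(ltW e0)// exprMn.
  have [->|m0] := eqVneq m 0.
    by rewrite ip0l !normr0 expr0n mul0r.
  rewrite mulrC -ler_pdivrMr ?exprn_gt0 ?normr_gt0//.
  (* Removing from [u - x] its component along [m] leaves [u] minus a point of [L], of squared norm
     at least [d]; hence that component has squared norm below [e ^+ 2]. *)
  rewrite -(lerD2l d) ltW// (le_lt_trans _ xd)//=.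
  rewrite [leRHS](norm_proj m) lerD2r -addrA -opprD; apply: dle; eexists; last by [].
  by rewrite addrC; exact: Llin.
rewrite (le_trans (cauchy_schwarz _ _))// ler_wpM2l// ltW//.
Qed.

End Projection.

(** * Bounded operators, the Riesz theorem and adjoints *)

Section Adjoint.
Context {R : realType}.
Implicit Types U V : hilbertType R.

Lemma linear_of_fun (U V : lmodType R[i]) (f : U -> V) :
  linear f -> exists g : {linear U -> V}, g =1 f.
Proof.
move=> lf; pose gf := GRing.isLinear.Build _ _ _ _ f lf.
by exists (HB.pack_for {linear U -> V} f gf).
Qed.

Lemma bounded_bop U V (f : U -> V) M : 0 <= M -> linear f ->
  (forall u, `|f u| <= M * `|u|) -> exists A : bop U V, A =1 f.
Proof.
move=> M0 lf fM; have [g gf] := linear_of_fun lf.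
have cg : continuous g.
  apply: bounded_linear_continuous; apply/linear_boundedP.
  exists M; split=> [|r Mr x]; first exact: ger0_real.
  by rewrite gf (le_trans (fM x))// ler_wpM2r// ltW.
have lg : linear g by move=> a x y; exact: linearP.
by exists (Bop lg cg).
Qed.

Lemma bop_bounded U V (A : bop U V) :
  exists2 M, 0 <= M & forall u, `|A u| <= M * `|u|.
Proof.
have /linear_bounded_continuous /linear_boundedP := @bop_continuous _ _ _ A.
move=> [M [Mr MA]]; exists (`|M| + 1); first by rewrite addr_ge0.
apply: MA; apply: (le_lt_trans (real_ler_norm Mr)).
by rewrite ltrDl ltr01.
Qed.

(** Subtracting from a vector outside the kernel its projection gives [n] orthogonal to the kernel;
    every [x] is a multiple of [n] plus a kernel vector, so a multiple of [n] represents [phi]. *)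
Lemma riesz V (phi : V -> R[i]) M : 0 <= M -> scalar phi ->
  (forall u, `|phi u| <= M * `|u|) -> exists w, phi =1 ip w.
Proof.
move=> M0 phil phiM.
have [phi0|/existsNP[u /eqP u0]] := pselect (forall u, phi u = 0).
  by exists 0 => u; rewrite phi0 ip0l.
have phi_0 : phi 0 = 0.
  by have := phil (-1) 0 0; rewrite scaler0 addr0 mulN1r addNr.
have phiB x y : phi (x - y) = phi x - phi y.
  by rewrite addrC -scaleN1r phil mulN1r addrC.
have [||p kp pu] := @orthogonal_projection R V [set x | phi x = 0] u => //.
  by move=> a x y /= x0 y0; rewrite phil x0 y0 mulr0 addr0.
(* The projection lies in the closure of the kernel; boundedness of [phi] puts it in the kernel. *)
have p0 : phi p = 0.
  apply/eqP; rewrite -normr_le0.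
  apply: (real_le_eps_mul M0) => e e0.
  have [x /= x0 px] := (closure_normP _ _).1 kp e e0.
  rewrite add0r -(subr0 (phi p)) -x0 -phiB (le_trans (phiM _))//.
  by rewrite ler_wpM2l// ltW.
pose n := u - p; have n0 : phi n != 0 by rewrite phiB p0 subr0.
have nn0 : `|n| != 0 by apply: contra_neq n0 => /eqP; rewrite normr_eq0 => /eqP ->.
exists ((phi n / `|n| ^+ 2)^* *: n) => x; rewrite ipZl conjCK.
have nx : ip n x = phi x / phi n * `|n| ^+ 2.
  rewrite -ipxx -ipZr; apply/eqP; rewrite -subr_eq0 -ipBr ip_conj pu ?conjC0//=.
  rewrite addrC -scaleNr phil mulNr divfK// addNr//.
by rewrite nx; field; rewrite n0.
Qed.

(** Riesz represents each functional [ip v (A u)] of [u]; linearity of the representing vector in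
    [v] follows from its uniqueness, and its bound from Cauchy-Schwarz at [u = B v]. *)
Lemma adjoint_exists U V (A : bop U V) :
  exists B : bop V U, forall u v, ip (A u) v = ip u (B v).
Proof.
have [M M0 AM] := bop_bounded A.
have /choice[B BA] v : exists w, forall u, ip (A u) v = ip u w.
  have [|||w wE] := @riesz U (fun u => ip v (A u)) (`|v| * M).
  - by rewrite mulr_ge0.
  - by move=> a x y /=; rewrite bop_linear ipDr ipZr.
  - by move=> u; rewrite (le_trans (cauchy_schwarz _ _))// -mulrA ler_wpM2l.
  by exists w => u; rewrite ip_conj wE -ip_conj.
have [|||C CB] := @bounded_bop V U B M => //.
- by move=> a x y; apply: ip_injr => z; rewrite -BA !ipDr !ipZr !BA.
- move=> v; have [->|B0] := eqVneq (B v) 0; first by rewrite normr0 mulr_ge0.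
  have Bv : 0 < `|B v| by rewrite normr_gt0.
  have BvE : `|B v| ^+ 2 = `|ip (A (B v)) v| by rewrite BA ipxx normrX normr_id.
  rewrite -(ler_pM2r Bv) -expr2 BvE (le_trans (cauchy_schwarz _ _))//.
  by rewrite mulrAC ler_wpM2r.
by exists C => u v; rewrite CB BA.
Qed.

Lemma adjointP U V (A : bop U V) u v : ip (A u) v = ip u (adjoint A v).
Proof. exact: (getPex (adjoint_exists A)). Qed.

End Adjoint.

(** * Continuous extension from a dense span *)

Section Extension.
Context {R : realType}.

(** Formal combinations are lists, in which an index may repeat, so that addition is concatenation
    and [I] can be any type. *)
Definition lincomb (I : Type) (U : lmodType R[i]) (e : I -> U)
  (s : seq (R[i] * I)) : U := \sum_(x <- s) x.1 *: e x.2.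

Lemma lincomb_nil I (U : lmodType R[i]) (e : I -> U) : lincomb e [::] = 0.
Proof. exact: big_nil. Qed.

Lemma lincomb_scale_cat I (U : lmodType R[i]) (e : I -> U) a s t :
  lincomb e ([seq (a * x.1, x.2) | x <- s] ++ t) =
  a *: lincomb e s + lincomb e t.
Proof.
rewrite /lincomb big_cat big_map scaler_sumr; congr (_ + _).
by apply: eq_bigr => x _; rewrite scalerA.
Qed.

Lemma lincomb1 I (U : lmodType R[i]) (e : I -> U) i : lincomb e [:: (1, i)] = e i.
Proof. by rewrite /lincomb big_seq1 scale1r. Qed.

Lemma bop_extend (I : Type) (U V : hilbertType R) (e : I -> U) (v : I -> V) M :
  0 <= M -> (forall s, `|lincomb v s| <= M * `|lincomb e s|) ->
  (forall u, closure (range (lincomb e)) u) ->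
  exists A : bop U V, forall i, A (e i) = v i.
Proof.
move=> M0 vM de.
have vMB s t : `|lincomb v s - lincomb v t| <= M * `|lincomb e s - lincomb e t|.
  have := vM ([seq (-1 * x.1, x.2) | x <- t] ++ s).
  by rewrite !lincomb_scale_cat !scaleN1r ![- _ + _]addrC.
have M1 : 0 < M + 1 by rewrite ltr_wpDl.
(* [A u] is a limit of [lincomb v s] as [lincomb e s] tends to [u]; a single [s] must serve both
   approximations. *)
have /choice[A AP] u : exists w, forall d, 0 < d ->
    exists2 s, `|u - lincomb e s| < d & `|w - lincomb v s| < d.
  pose P d := [set lincomb v s | s in [set s | `|u - lincomb e s| < d]].
  have [d d0|d d' dd' _ [s /= sd <-]|d d0|w wP] := @cauchy_net_limit R V P.
  - have [_ [s _ <-] us] := (closure_normP _ _).1 (de u) _ d0.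
    by exists (lincomb v s), s.
  - by exists s => //=; exact: lt_le_trans dd'.
  (* Two combinations this close to [u] differ by at most [d / (M + 1)], so their images differ by
     less than [d]. *)
  - exists (d / (2 * (M + 1))); first by rewrite divr_gt0// mulr_gt0.
    move=> _ _ [s /= us <-] [t /= ut <-].
    rewrite (le_lt_trans (vMB _ _))//.
    have -> : lincomb e s - lincomb e t = (u - lincomb e t) - (u - lincomb e s).
      by rewrite opprB [RHS]addrC addrA subrK.
    apply: (@le_lt_trans _ _ (M * (d / (M + 1)))).
      rewrite ler_wpM2l// (le_trans (ler_normB _ _))//.
      have -> : d / (M + 1) = d / (2 * (M + 1)) + d / (2 * (M + 1)).
        by field; rewrite gt_eqF.
      by rewrite lerD// ltW.
    by rewrite mulrCA gtr_pMr// ltr_pdivrMr// mul1r ltrDl ltr01.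
  exists w => d d0; have [_ [s /= us <-] ws] := wP d d0.
  by exists s.
have AB u s : `|A u - lincomb v s| <= M * `|u - lincomb e s|.
  apply: (@real_le_eps_mul R (M + 1)) => [|d d0]; first exact: ltW.
  have [t ut At] := AP u d d0.
  have -> : A u - lincomb v s = (lincomb v t - lincomb v s) + (A u - lincomb v t).
    by rewrite [RHS]addrC addrA subrK.
  rewrite (le_trans (ler_normD _ _))// mulrDl mul1r addrA lerD ?(ltW At)//.
  rewrite (le_trans (vMB _ _))// -mulrDr ler_wpM2l//.
  have -> : lincomb e t - lincomb e s = (u - lincomb e s) - (u - lincomb e t).
    by rewrite opprB [RHS]addrC addrA subrK.
  by rewrite (le_trans (ler_normB _ _))// lerD2l ltW.
have Ae s : A (lincomb e s) = lincomb v s.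
  apply/eqP; rewrite -subr_eq0 -normr_le0 (le_trans (AB _ _))//.
  by rewrite subrr normr0 mulr0.
have [a x y|u|B BA] := @bounded_bop R U V A M M0; last first.
- by exists B => i; rewrite BA -(lincomb1 e) Ae lincomb1.
(* The empty combination turns [AB] into the norm bound. *)
- by have := AB u [::]; rewrite !lincomb_nil !subr0.
apply/eqP; rewrite -subr_eq0 -normr_le0.
apply: (@real_le_eps_mul R ((M + 1) * (`|a| + 1))) => [|d d0].
  by rewrite mulr_ge0 ?ltW// ltr_wpDl.
have [s xs As] := AP x d d0; have [t yt At] := AP y d d0.
(* One list approximates both [a *: x + y] through [e] and [a *: A x + A y] through [v], each within
   [(|a| + 1) * d]; [AB] costs a further factor [M] on the first. *)
pose r := [seq (a * z.1, z.2) | z <- s] ++ t.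
have rP (W : normedModType R[i]) (f : I -> W) p q : `|p - lincomb f s| < d ->
    `|q - lincomb f t| < d -> `|a *: p + q - lincomb f r| <= (`|a| + 1) * d.
  move=> ps qt; rewrite lincomb_scale_cat opprD addrACA -scalerBr.
  rewrite (le_trans (ler_normD _ _))// normrZ mulrDl mul1r.
  by rewrite lerD ?ler_wpM2l ?(ltW ps) ?(ltW qt).
rewrite add0r; set Axy := A (_ + _).
have -> : Axy - (a *: A x + A y) = (Axy - lincomb v r) - (a *: A x + A y - lincomb v r).
  by rewrite opprB addrA subrK.
rewrite (le_trans (ler_normB _ _))// -mulrA mulrDl mul1r lerD ?rP//.
by rewrite (le_trans (AB _ _))// ler_wpM2l// rP.
Qed.

End Extension.

(** * Total families: density, uniqueness and isometric extension *)

Section TotalFamily.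
Context {R : realType} {I : Type} {U V : hilbertType R}.

(** Totality as a trivial orthogonal complement, the form that reproducing kernels satisfy at once;
    [total_dense] turns it into density of the span. *)
Definition total_family (e : I -> U) := forall u, (forall i, ip (e i) u = 0) -> u = 0.

Lemma total_dense (e : I -> U) : total_family e ->
  forall u, closure (range (lincomb e)) u.
Proof.
move=> te u; have [||p pL pu] := @orthogonal_projection R U (range (lincomb e)) u.
- by exists [::] => //; exact: lincomb_nil.
- move=> a _ _ [s _ <-] [t _ <-].
  by eexists; last exact: lincomb_scale_cat.
have -> // : u = p.
apply/eqP; rewrite -subr_eq0; apply/eqP; apply: te => i; apply: pu.
by exists [:: (1, i)] => //; exact: lincomb1.
Qed.

Lemma total_eq (e : I -> U) x y : total_family e ->
  (forall i, ip (e i) x = ip (e i) y) -> x = y.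
Proof.
move=> te xy; apply/eqP; rewrite -subr_eq0; apply/eqP; apply: te => i.
by rewrite ipBr xy subrr.
Qed.

(* The adjoints agree because they have the same coefficients against [e]. *)
Lemma total_bop_eq (e : I -> U) (A B : bop U V) : total_family e ->
  (forall i, A (e i) = B (e i)) -> A = B.
Proof.
move=> te AB; apply: bop_ext => u; apply: ip_injr => z.
rewrite ip_conj adjointP (_ : adjoint A z = adjoint B z) -?adjointP -?ip_conj//.
by apply: (total_eq te) => i; rewrite -!adjointP AB.
Qed.

(** Equal Gram matrices give combinations of equal norm, so [bop_extend] applies with bound 1. *)
Lemma isometry_extend (e : I -> U) (v : I -> V) : total_family e ->
  (forall i j, ip (v i) (v j) = ip (e i) (e j)) ->
  exists A : bop U V, isometric A /\ forall i, A (e i) = v i.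
Proof.
move=> te ve.
have [//|s||A Ae] := @bop_extend R I U V e v 1.
- rewrite mul1r -(@ler_pXn2r _ 2)// ?nnegrE//.
  rewrite -!ipxx /lincomb !ip_suml le_eqVlt; apply/orP; left; apply/eqP.
  apply: eq_bigr => x _; rewrite !ip_sumr; apply: eq_bigr => y _.
  by rewrite !ipZl !ipZr ve.
- exact: total_dense.
exists A; split=> // u.
(* [A] is isometric as soon as [A^* A = 1]. *)
have AAe i : adjoint A (A (e i)) = e i.
  by apply: (total_eq te) => j; rewrite -adjointP !Ae ve.
have AAu : adjoint A (A u) = u.
  apply: (total_eq te) => i.
  by rewrite -adjointP ip_conj adjointP AAe -ip_conj.
by apply/eqP; rewrite -(@eqrXn2 _ 2)// -!ipxx adjointP AAu.
Qed.

End TotalFamily.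

(** * Orthogonalizing the second factors of a sum of pure tensors *)

Section GramSchmidt.
Context {R : realType} {K : hilbertType R}.

Definition orthogonal_seq (T : Type) (g : T -> K) :=
  pairwise (fun x y => ip (g x) (g y) == 0).

Lemma ip_sum_eq0 (T : Type) (g : T -> K) (c : T -> R[i]) y (s : seq T) :
  all (fun x => ip y (g x) == 0) s -> ip y (\sum_(x <- s) c x *: g x) = 0.
Proof.
elim: s => [_|x s IH /= /andP[/eqP yx /IH ys]]; first by rewrite big_nil ip0r.
by rewrite big_cons ipDr ipZr yx mulr0 add0r.
Qed.

Lemma orthogonal_seq_residual (T : Type) (g : T -> K) (b : K) (s : seq T) :
  orthogonal_seq g s ->
  all (fun x =>
    ip (g x) (b - \sum_(y <- s) (ip (g y) b / `|g y| ^+ 2) *: g y) == 0) s.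
Proof.
elim: s => //= y s IH /andP[ys /IH bs]; rewrite big_cons; apply/andP; split.
  by rewrite opprD addrA ipBr ip_proj ip_sum_eq0// subrr.
have : all (predI (fun x => ip (g y) (g x) == 0) (fun x =>
    ip (g x) (b - \sum_(z <- s) (ip (g z) b / `|g z| ^+ 2) *: g z) == 0)) s.
  by rewrite all_predI ys.
apply: sub_all => x /andP[/eqP yx /eqP bx].
by rewrite opprD addrCA addrC ipBr bx ipZr (ip_conj (g y)) yx conjC0 mulr0 subrr.
Qed.

(** A Gram-Schmidt step replaces [b] by its residual [b'] and moves each removed component
    [t y *: y] into the first factor paired with [y]. Quantifying over all bilinear [B] lets one
    list rewrite a sum of tensors and its image under an operator. *)
Lemma bilinear_orthogonalize (H : hilbertType R) (s : seq (H * K)) :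
  exists2 s', orthogonal_seq snd s' &
    forall (W : lmodType R[i]) (B : H -> K -> W),
      (forall b, linear (B^~ b)) -> (forall a, linear (B a)) ->
      \sum_(x <- s) B x.1 x.2 = \sum_(x <- s') B x.1 x.2.
Proof.
elim: s => [|[a b] s [s' os' ss']]; first by exists [::].
pose t (y : K) := ip y b / `|y| ^+ 2.
pose b' := b - \sum_(y <- s') t y.2 *: y.2.
exists ((a, b') :: [seq (x.1 + t x.2 *: a, x.2) | x <- s']).
  rewrite /orthogonal_seq /= pairwise_map; apply/andP; split; last exact: os'.
  rewrite all_map; apply: sub_all (orthogonal_seq_residual b os') => x /= /eqP b'x.
  by rewrite ip_conj b'x conjC0.
move=> W B Bl Br; rewrite !big_cons/= big_map/= (ss' _ _ Bl Br).
have [f fE] := linear_of_fun (Br a); rewrite -!fE /b' linearB linear_sum /=.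
rewrite -addrA; congr (_ + _).
have -> : \sum_(x <- s') B (x.1 + t x.2 *: a) x.2 =
    \sum_(x <- s') B x.1 x.2 + \sum_(x <- s') f (t x.2 *: x.2).
  rewrite -big_split; apply: eq_bigr => x _ /=.
  have := Bl x.2 (t x.2) a x.1; rewrite linearZ fE /= [x.1 + _]addrC => ->.
  exact: addrC.
by rewrite addrCA addNr addr0.
Qed.

End GramSchmidt.

(** * Existence and values of [S (x) 1] *)

Section TensorOperator.
Context {R : realType}.

Lemma norm_sum_tens (H K : hilbertType R) (T : tensor H K) (s : seq (H * K)) :
  orthogonal_seq snd s ->
  `|\sum_(x <- s) tens T x.1 x.2| ^+ 2 =
  \sum_(x <- s) `|x.1| ^+ 2 * `|x.2| ^+ 2.
Proof.
elim: s => [_|[a b] s IH /= /andP[bs /IH sE]].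
  by rewrite !big_nil normr0 expr0n.
rewrite !big_cons/= pythagoras ?sE; first by rewrite -ipxx ip_tens !ipxx.
rewrite ip_sumr; elim: s bs {IH sE} => [|x s IH /= /andP[/eqP bx /IH bs]].
  by rewrite big_nil.
by rewrite big_cons bs ip_tens bx mulr0 addr0.
Qed.

(** With orthogonal second factors both squared norms are sums of products by [norm_sum_tens], so
    the bound for [A] applies term by term and [bop_extend] gives the operator. *)
Lemma tensor_bop1E (H K H' : hilbertType R) (T : tensor H K) (T' : tensor H' K)
    (A : bop H H') a b : tensor_bop T T' A (bop1 K) (tens T a b) = tens T' (A a) b.
Proof.
rewrite /tensor_bop; set P := [set C | _].
suff /getPex : exists C, P C by apply.
pose e (x : H * K) := tens T x.1 x.2.
pose v (x : H * K) := tens T' (A x.1) x.2.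
have [M M0 AM] := bop_bounded A.
have [//|s|u|C CE] := @bop_extend R (H * K)%type T T' e v M.
(* Scalar coefficients are absorbed into the first factors. *)
- pose s1 := [seq (x.1 *: x.2.1, x.2.2) | x <- s].
  have tZ (H1 : hilbertType R) (T1 : tensor H1 K) c x y :
      c *: tens T1 x y = tens T1 (c *: x) y.
    by have [h hE] := linear_of_fun (tens_linearl T1 y); rewrite -!hE linearZ.
  have -> : lincomb e s = \sum_(x <- s1) tens T x.1 x.2.
    by rewrite /lincomb big_map; apply: eq_bigr => x _; rewrite tZ.
  have -> : lincomb v s = \sum_(x <- s1) tens T' (A x.1) x.2.
    by rewrite /lincomb big_map; apply: eq_bigr => x _; rewrite tZ linearZ.
  have [s2 os2 s12] := bilinear_orthogonalize s1.
  rewrite (s12 _ _ (tens_linearl T) (tens_linearr T)).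
  rewrite (s12 _ (fun x y => tens T' (A x) y)); last first.
  + by move=> x; exact: tens_linearr.
  + by move=> y c x x'; rewrite bop_linear tens_linearl.
  rewrite -(@ler_pXn2r _ 2)// ?nnegrE ?mulr_ge0// exprMn.
  have -> : \sum_(x <- s2) tens T' (A x.1) x.2 =
      \sum_(x <- [seq (A x.1, x.2) | x <- s2]) tens T' x.1 x.2.
    by rewrite big_map.
  rewrite !norm_sum_tens//; last by rewrite /orthogonal_seq pairwise_map.
  rewrite big_map mulr_sumr ler_sum// => x _ /=.
  by rewrite [leRHS]mulrA ler_wpM2r ?exprn_ge0// -exprMn lerXn2r ?nnegrE ?mulr_ge0.
- have : closure [set t | exists n (a : 'I_n -> H) (b : 'I_n -> K),
      t = \sum_(i < n) tens T (a i) (b i)] u by rewrite tens_dense.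
  apply: closure_subset => _ [n [a' [b' ->]]].
  exists [seq (1, (a' i, b' i)) | i <- enum 'I_n] => //.
  rewrite /lincomb big_map big_enum /=.
  by apply: eq_bigr => i _; rewrite scale1r.
by exists C => x y; exact: (CE (x, y)).
Qed.

End TensorOperator.

(** * Szegő and de Branges-Rovnyak kernels, and the maps [Phi] *)

Section ReproducingKernels.
Context {R : realType}.

Lemma elt_of_eval (X : Type) (H : hfspace R X) (F : X -> R[i]) (h : H) :
  hfs_eval h = F -> elt_of H F = h.
Proof.
move=> hF; apply: hfs_eval_inj; rewrite hF.
by apply: (@xgetPex _ 0 [set h : H | hfs_eval h = F]); exists h.
Qed.

Lemma reproducing_total (X : Type) (H : hfspace R X) (e : X -> H) :
  (forall w h, ip (e w) h = hfs_eval h w) -> total_family e.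
Proof.
by move=> eE u u0; apply: hfs_eval_inj; apply/funext => w; rewrite -!eE u0 ip0r.
Qed.

Lemma cvg_geometric_series_complex (q : R[i]) : `|q| < 1 ->
  (series (fun n => q ^+ n) : nat -> R[i]^o) @ \oo --> ((1 - q)^-1 : R[i]^o).
Proof.
move=> q1; have q_neq1 : 1 - q != 0.
  by rewrite subr_eq0; apply: contraTneq q1 => <-; rewrite normr1 ltxx.
have -> : series (fun n => q ^+ n) = (fun n => (1 - q)^-1 - (1 - q)^-1 * q ^+ n).
  apply/funext => n; rewrite /series /= big_mkord.
  apply: (mulfI q_neq1); rewrite -[LHS]opprK -mulNr opprB -subrX1.
  by field.
(* The norms are powers of a real number below 1, so convergence is transferred from [R]. *)
have qn : ((fun n => q ^+ n) : nat -> R[i]^o) @ \oo --> (0 : R[i]^o).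
  apply/cvgrPdist_lt => e e0.
  have rE := RRe_real (normr_real q); have eE := RRe_real (gtr0_real e0).
  have r0 : 0 <= complex.Re `|q| by rewrite -lecR rE normr_ge0.
  have r1 : `|complex.Re `|q| | < 1 by rewrite ger0_norm// -ltcR rE.
  have e0' : 0 < complex.Re e by rewrite -ltcR eE.
  have qnE n : `|q ^+ n| = (complex.Re `|q| ^+ n)%:C%C.
    by rewrite normrX -[in LHS]rE -[LHS](rmorphXn (real_complex R)).
  have /cvgrPdist_lt /(_ _ e0') := cvg_expr r1; apply: filterS => n.
  by rewrite !sub0r !normrN qnE ger0_norm ?exprn_ge0// -ltcR eE.
rewrite -[X in _ --> X]subr0 -[X in _ --> _ - X](mulr0 (1 - q)^-1).
by apply: cvgB; [exact: cvg_cst|apply: cvgM; [exact: cvg_cst|exact: qn]].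
Qed.

Lemma disk_norm_mul_conj (z w : disk R) : `|val z * (val w)^*| < 1.
Proof.
by rewrite normrM norm_conjC mulr_ilt1// (valP z, valP w).
Qed.

Lemma disk_one_sub_neq0 (z w : disk R) : 1 - val z * (val w)^* != 0.
Proof.
rewrite subr_eq0; apply: contraTneq (disk_norm_mul_conj z w) => <-.
by rewrite normr1 ltxx.
Qed.

Section Hardy.
Variable H2 : hardy R.

(** The function [szego^~ w] has Taylor coefficients [(val w)^* ^+ n]; pairing them with those of
    [h] gives the power series of [h] at [w]. *)
Lemma kvecP (w : disk R) : hfs_eval (kvec H2 w) = (@szego R)^~ w /\
  forall h : H2, ip (kvec H2 w) h = hfs_eval h w.
Proof.
pose a n : R[i] := (val w)^* ^+ n.
have sa : square_summable a.
  apply/cvg_ex; exists ((1 - `|val w| ^+ 2)^-1).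
  have -> : (fun n => `|a n| ^+ 2) = (fun n => (`|val w| ^+ 2) ^+ n).
    by apply/funext => n; rewrite normrX norm_conjC exprAC.
  apply: cvg_geometric_series_complex.
  by rewrite normrX normr_id expr_lt1// (valP w).
have pa : power_series_of a ((@szego R)^~ w).
  move=> z; have -> : (fun n => a n * val z ^+ n) =
      (fun n => (val z * (val w)^*) ^+ n).
    by apply/funext => n; rewrite -exprMn mulrC.
  exact/cvg_geometric_series_complex/disk_norm_mul_conj.
have [k kE] : exists k : H2, hfs_eval k = (@szego R)^~ w.
  by apply/(hardy_mem H2); exists a.
rewrite /kvec (elt_of_eval kE); split=> // h.
have [b sb pb] := (hardy_mem H2 (hfs_eval h)).1 (ex_intro _ h erefl).
rewrite -kE in pa; have := hardy_ip sa pa sb pb.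
have -> : (fun n => (a n)^* * b n) = (fun n => b n * val w ^+ n).
  by apply/funext => n; rewrite /a rmorphXn /= conjCK mulrC.
by move=> kh; apply: (cvg_unique _ kh (pb w)); exact: norm_hausdorff.
Qed.

Lemma ip_kvec z w : ip (kvec H2 z) (kvec H2 w) = szego z w.
Proof. by rewrite (kvecP z).2 (kvecP w).1. Qed.

Lemma kvec_total : total_family (kvec H2).
Proof. by apply: reproducing_total => w h; exact: (kvecP w).2. Qed.

End Hardy.

Section DeBrangesRovnyak.
Variables (phi : disk R -> disk R) (Hphi : dBR phi).

Lemma cvecP w : hfs_eval (cvec Hphi w) = (dbr_kernel phi)^~ w /\
  forall h : Hphi, ip (cvec Hphi w) h = hfs_eval h w.
Proof. by have [k kE kh] := rkhs_kernel Hphi w; rewrite /cvec (elt_of_eval kE). Qed.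

Lemma ip_cvec z w : ip (cvec Hphi z) (cvec Hphi w) = dbr_kernel phi z w.
Proof. by rewrite (cvecP z).2 (cvecP w).1. Qed.

Lemma cvec_total : total_family (cvec Hphi).
Proof. by apply: reproducing_total => w h; exact: (cvecP w).2. Qed.

(** The numerator of [dbr_kernel phi] cancels the Szegő kernel at [phi z], [phi w], so both families
    have the Gram matrix [szego] and the isometry exists. *)
Lemma VopE (H2 : hardy R) (T : tensor H2 Hphi) w :
  Vop T (kvec H2 w) = tens T (kvec H2 (phi w)) (cvec Hphi w).
Proof.
rewrite /Vop; set P := [set V | _].
suff /getPex : exists V, P V by case=> _; exact.
apply: isometry_extend; first exact: kvec_total.
move=> z z'; rewrite ip_tens !ip_kvec ip_cvec /szego /dbr_kernel.
by rewrite mulrA mulVf ?mul1r// disk_one_sub_neq0.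
Qed.

Lemma ip_kvec_Phi (H2 : hardy R) (T : tensor H2 Hphi) S z w :
  ip (kvec H2 z) (Phi T S (kvec H2 w)) =
  ip (kvec H2 (phi z)) (S (kvec H2 (phi w))) * dbr_kernel phi z w.
Proof.
by rewrite /Phi /= -adjointP !VopE tensor_bop1E ip_tens ip_cvec.
Qed.

End DeBrangesRovnyak.

Lemma dbr_kernel_comp (f g : disk R -> disk R) z w :
  dbr_kernel (g \o f) z w = dbr_kernel g (f z) (f w) * dbr_kernel f z w.
Proof. by rewrite /dbr_kernel /= mulrA divfK// disk_one_sub_neq0. Qed.

End ReproducingKernels.

(** * The isometry [J] and the composition rule *)

Theorem proposition4p8 (R : realType) (H2 : hardy R) (f g : disk R -> disk R)
    (hf : holomorphic_disk f) (hg : holomorphic_disk g)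
    (Hf : dBR f) (Hg : dBR g) (Hgf : dBR (g \o f))
    (Tgf : tensor Hg Hf)
    (T2f : tensor H2 Hf) (T2g : tensor H2 Hg) (T2gf : tensor H2 Hgf) :
  (exists! J : bop Hgf Tgf,
     isometric J /\
     forall w : disk R, J (cvec Hgf w) = tens Tgf (cvec Hg (f w)) (cvec Hf w))
  /\ Phi T2f \o Phi T2g = Phi T2gf.
Proof.
split.
  have [|J [Jiso JE]] := @isometry_extend R _ _ Tgf (cvec Hgf)
    (fun w => tens Tgf (cvec Hg (f w)) (cvec Hf w)) (@cvec_total _ _ Hgf).
    by move=> z w; rewrite ip_tens !ip_cvec dbr_kernel_comp.
  exists J; split=> // J' [_ J'E].
  by apply: (total_bop_eq (@cvec_total _ _ Hgf)) => w; rewrite JE J'E.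
apply/funext => S; apply: (total_bop_eq (@kvec_total _ H2)) => w.
apply: (total_eq (@kvec_total _ H2)) => z /=.
(* The outer map moves the points to [f z], [f w] with factor c_f(z, w); the inner one then moves
   them to [g (f z)], [g (f w)] with factor c_g(f z, f w). *)
by rewrite !ip_kvec_Phi dbr_kernel_comp mulrA.
Qed.
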